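(* Let $n\ge1$, let $G\in\mathbb R^{n\times n}$ have positive-definite symmetric part $\tfrac12(G+G^{\mathsf T})$, and let $b\in\mathbb R^n$ and $B\ge0$. Consider the following procedure. Starting from any $x_0\in\mathbb R^n$, stop at index $k$ if $Gx_k\ge b$ componentwise. Otherwise choose an index $i_k\in\{1,\dots,n\}$ and update according to $$(Gx_k-b)_{i_k}\le\min_{1\le i\le n}(Gx_k-b)_i+B,\qquad x_{k+1}=x_k+e_{i_k}.$$ For every admissible choice of indices, the procedure stops after a finite number $T$ of corrections at a point satisfying $Gx_T\ge b$. Moreover, there is a constant $C=C(n,G)\ge1$, independent of $b$, $B$, $x_0$ and the selections, such that, with $\rho=\|x_0-G^{-1}b\|$, $$T\le\sqrt n\,\bigl[C(1+B)+(C+1)\rho\bigr].$$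
   Context: $e_i$ denotes the $i$th standard basis vector of $\mathbb R^n$, and $\|\cdot\|$ is the Euclidean norm. A matrix with positive-definite symmetric part is invertible, so $G^{-1}b$ is defined. *)

(* Defs.v *)
From HB Require Import structures.
From mathcomp Require Import all_boot all_order all_algebra.
From mathcomp Require Import reals.

Set Implicit Arguments.
Unset Strict Implicit.
Unset Printing Implicit Defensive.

Import Order.TTheory GRing.Theory Num.Theory.
Local Open Scope ring_scope.

Section Definitions.
Variables (R : realType) (n : nat).
Implicit Types (G S : 'M[R]_n) (b v x : 'cV[R]_n) (B : R).

Definition sympart G : 'M[R]_n := 2^-1 *: (G + G^T).

Definition posdefmx S : Prop :=
  S^T = S /\ forall x, x != 0 -> 0 < (x^T *m S *m x) 0 0.

(* The library norm on matrices is the max norm, hence this definition. *)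
Definition norm2 v : R := Num.sqrt (\sum_(i < n) v i 0 ^+ 2).

(* The default value of the iterated minimum is itself a coordinate of v, so
   this is the plain minimum of the coordinates (see vminP). *)
Definition vmin (n_gt0 : (0 < n)%N) v : R :=
  \big[Num.min/v (Ordinal n_gt0) 0]_(i < n) v i 0.

Definition feasible G b x : bool := [forall i, b i 0 <= (G *m x) i 0].

Definition selectable (n_gt0 : (0 < n)%N) G b B x (i : 'I_n) : Prop :=
  (G *m x - b) i 0 <= vmin n_gt0 (G *m x - b) + B.

Fixpoint iterate x0 (s : nat -> 'I_n) (k : nat) : 'cV[R]_n :=
  if k is k'.+1 then iterate x0 s k' + delta_mx (s k') 0 else x0.

(* Only the choices made before the procedure stops are constrained, so every
   (finite or infinite) execution is described by an infinite sequence s whose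
   values after the stopping index are irrelevant. *)
Definition admissible (n_gt0 : (0 < n)%N) G b B x0 (s : nat -> 'I_n) : Prop :=
  forall k, (forall j, (j <= k)%N -> ~~ feasible G b (iterate x0 s j)) ->
    selectable n_gt0 G b B (iterate x0 s k) (s k).

Definition stops_at G b x0 (s : nat -> 'I_n) (T : nat) : Prop :=
  feasible G b (iterate x0 s T) /\
  forall k, (k < T)%N -> ~~ feasible G b (iterate x0 s k).

Lemma vminP (n_gt0 : (0 < n)%N) v :
  (exists i, vmin n_gt0 v = v i 0) /\ (forall i, vmin n_gt0 v <= v i 0).
Proof.
split; last by move=> i; apply: bigmin_le_cond.
rewrite /vmin; elim/big_ind: _ => [|x y [i ->] [j ->]|i _].
- by exists (Ordinal n_gt0).
- by case: (leP (v i 0) (v j 0)) => _; [exists i|exists j].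
- by exists i.
Qed.

Lemma posdef_sympart_unitmx G : posdefmx (sympart G) -> G \in unitmx.
Proof.
move=> [_ pos]; rewrite -row_free_unit; apply/inj_row_free => u uG0.
apply/eqP; apply: contraT => u_neq0.
have := pos u^T; rewrite trmx_eq0 => /(_ u_neq0).
rewrite trmxK /sympart -scalemxAr -scalemxAl mulmxDr mulmxDl uG0 mul0mx add0r.
by rewrite -mulmxA -trmx_mul uG0 trmx0 mulmx0 scaler0 mxE ltxx.
Qed.

End Definitions.

(* Main.v *)
Require Import Defs.
From HB Require Import structures.
From mathcomp Require Import all_boot all_order all_algebra.
From mathcomp Require Import reals.
From mathcomp Require Import ring lra.

Set Implicit Arguments.
Unset Strict Implicit.
Unset Printing Implicit Defensive.

Import Order.TTheory GRing.Theory Num.Theory.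
Local Open Scope ring_scope.

(** The proof follows the smallest residual m_k = min_i (G x_k - b)_i, which is
    negative as long as the procedure runs. A single correction may decrease
    it, but over well-chosen windows of steps it grows linearly.

    Let N be the vector counting how often each index is selected during a
    window [t - L, t). Over this window the residual changes by G N, hence the
    sum of this change over the selected indices is N^T G N. Positivity of the
    symmetric part gives N^T G N >= L^2 / kappa for a constant kappa
    ([sum_sq_le_quad]), while the residual of any index is at least m_(t-L) at
    the start of the window. If moreover all indices selected in the window
    have residual at most m_t + D at its end, then
    L <= kappa (m_t - m_(t-L) + D) ([window_drift]).

    An index selected among the last l steps has residual at most
    m_t + B + 2 g l at time t, because it was within B of the minimum when it
    was selected and all residuals move by at most g per step
    ([recent_near_vmin]). So the window
    should be much longer than l although all its indices reappear among the
    last l steps. Such a pair of lengths exists among M, q M, q^2 M, ...: the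
    sets of indices selected in the last q^j M steps increase with j, and
    there are only n indices, so two consecutive ones coincide for some j <= n
    ([increasing_sets_repeat]). With q large compared with kappa (1 + 2 g) and
    M the least integer above B, m grows by at least L / (2 kappa) over that
    window ([drift]).

    Going backwards from t by such windows until fewer than q^(n+1) M steps
    remain gives m_t >= m_0 + t / (2 kappa) - O(1 + B) ([vmin_growth]). As
    m_0 >= - g rho, the procedure cannot run longer than O(1 + B + rho). *)

(** * Positive-definite symmetric part *)

Section QuadraticForm.
Variables (R : realType) (n : nat).
Implicit Types (G S : 'M[R]_n) (x y : 'cV[R]_n).

Lemma quad_sympart G x : (x^T *m sympart G *m x) 0 0 = (x^T *m G *m x) 0 0.
Proof.
have GT : (x^T *m G^T *m x) 0 0 = (x^T *m G *m x) 0 0.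
  rewrite -[in RHS](trmxK (x^T *m G *m x)) [in RHS]mxE.
  by rewrite !trmx_mul trmxK mulmxA.
rewrite /sympart -scalemxAr -scalemxAl mulmxDr mulmxDl mxE [X in _ * X]mxE GT.
by field.
Qed.

(** Cauchy-Schwarz for the scalar product of S = sympart G, applied to x and
    the solution w of S w = (1, ..., 1)^T: the coordinate sum of x is
    w^T S x, and kappa = w^T S w. *)
Lemma sum_sq_le_quad G : posdefmx (sympart G) ->
  exists2 kappa : R, 0 < kappa &
    forall x, (\sum_i x i 0) ^+ 2 <= kappa * (x^T *m G *m x) 0 0.
Proof.
move=> posG; have [symS posS] := posG.
have symK : sympart (sympart G) = sympart G.
  rewrite {1}/sympart symS -mulr2n -scaler_nat scalerA mulVf ?scale1r //.
  by rewrite pnatr_eq0.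
have Sunit : sympart G \in unitmx.
  by apply: posdef_sympart_unitmx; rewrite symK.
move: (sympart G) (quad_sympart G) symS posS Sunit => S quadS symS posS Sunit.
pose w : 'cV[R]_n := invmx S *m const_mx 1.
have Sw : S *m w = const_mx 1 by rewrite mulKVmx.
have wSE x : (w^T *m S *m x) 0 0 = \sum_i x i 0.
  rewrite -[in w^T *m S]symS -trmx_mul Sw mxE.
  by apply: eq_bigr => i _; rewrite !mxE mul1r.
have SwE x : (x^T *m S *m w) 0 0 = \sum_i x i 0.
  by rewrite -mulmxA Sw mxE; apply: eq_bigr => i _; rewrite !mxE mulr1.
(* Here all coordinate sums vanish, which happens only for n = 0. *)
have [w0|w_neq0] := eqVneq w 0.
  exists 1 => // x; rewrite -wSE w0 trmx0 !mul0mx mxE expr0n /= mul1r -quadS.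
  have [->|x_neq0] := eqVneq x 0; first by rewrite mulmx0 mxE.
  exact/ltW/posS.
have kappa_gt0 : 0 < \sum_i w i 0 by rewrite -wSE posS.
exists (\sum_i w i 0) => // x; rewrite -quadS.
set kappa := \sum_i w i 0 in kappa_gt0 *.
set L := \sum_i x i 0.
(* Up to the factor kappa, z is the S-orthogonal projection of x off w. *)
pose z := kappa *: x - L *: w.
have zE : (z^T *m S *m z) 0 0 = kappa * (kappa * (x^T *m S *m x) 0 0 - L ^+ 2).
  have zT : z^T = kappa *: x^T - L *: w^T by rewrite /z linearB !linearZ.
  rewrite zT /z !mulmxBl !mulmxBr -!scalemxAl -!scalemxAr.
  have entryB (A1 A2 : 'M[R]_1) : (A1 - A2) 0 0 = A1 0 0 - A2 0 0.
    by rewrite !mxE.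
  have entryZ a (A1 : 'M[R]_1) : (a *: A1) 0 0 = a * A1 0 0 by rewrite mxE.
  by rewrite !(entryB, entryZ) SwE !wSE -/L -/kappa; ring.
have : 0 <= (z^T *m S *m z) 0 0.
  have [->|z_neq0] := eqVneq z 0; first by rewrite mulmx0 mxE.
  exact/ltW/posS.
by rewrite zE pmulr_rge0 // subr_ge0.
Qed.

End QuadraticForm.

(** * Size of the entries *)

Section EntrySum.
Variables (R : realType) (n : nat) (G : 'M[R]_n).

(** A crude bound that serves both for the effect of one correction on the
    residual and for the operator norm from Euclidean to max norm. *)
Definition entry_sum : R := \sum_i \sum_j `|G i j|.

Lemma entry_sum_ge0 : 0 <= entry_sum.
Proof. by apply: sumr_ge0 => i _; apply: sumr_ge0. Qed.

Lemma row_sum_le i : \sum_j `|G i j| <= entry_sum.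
Proof.
rewrite /entry_sum [leRHS](bigD1 i) //= lerDl.
by apply: sumr_ge0 => k _; apply: sumr_ge0.
Qed.

Lemma entry_le i j : `|G i j| <= entry_sum.
Proof.
apply: le_trans (row_sum_le i).
by rewrite (bigD1 j) //= lerDl; apply: sumr_ge0.
Qed.

Lemma coord_le_norm2 (v : 'cV[R]_n) i : `|v i 0| <= norm2 v.
Proof.
rewrite /norm2 -sqrtr_sqr ler_wsqrtr // (bigD1 i) //= lerDl.
by apply: sumr_ge0 => j _; apply: sqr_ge0.
Qed.

Lemma mulmx_coord_ge (v : 'cV[R]_n) i : - (entry_sum * norm2 v) <= (G *m v) i 0.
Proof.
suff: `|(G *m v) i 0| <= entry_sum * norm2 v by rewrite ler_norml => /andP[].
rewrite mxE; apply: le_trans (ler_norm_sum _ _ _) _.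
apply: (@le_trans _ _ (\sum_j `|G i j| * norm2 v)).
  apply: ler_sum => j _; rewrite normrM ler_wpM2l //.
  exact: coord_le_norm2.
by rewrite -mulr_suml ler_wpM2r ?sqrtr_ge0 // row_sum_le.
Qed.

End EntrySum.

(** * Increasing chains of sets *)

(** Otherwise the cardinals would increase strictly n + 1 times. *)
Lemma increasing_sets_repeat (n : nat) (S : nat -> {set 'I_n}) :
  (forall j, S j \subset S j.+1) -> exists2 j, (j <= n)%N & S j.+1 = S j.
Proof.
move=> incS.
suff /existsP[j /eqP Sj] : [exists j : 'I_n.+1, S j.+1 == S j].
  by exists j => //; rewrite -ltnS.
rewrite -[X in is_true X]negbK; apply/negP; rewrite negb_exists => /forallP neqS.
have card_ge j : (j <= n.+1)%N -> (j <= #|S j|)%N.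
  elim: j => // j IHj lt_jn; apply: leq_ltn_trans (IHj (ltnW lt_jn)) _.
  apply: proper_card; rewrite properEneq incS andbT eq_sym.
  exact: (neqS (Ordinal lt_jn)).
by have := leq_trans (card_ge _ (leqnn _)) (max_card _); rewrite card_ord ltnn.
Qed.

(** * Growth of the smallest residual *)

Section Run.
Variables (R : realType) (n : nat) (n_gt0 : (0 < n)%N) (G : 'M[R]_n).
Variables (b : 'cV[R]_n) (B : R) (x0 : 'cV[R]_n) (s : nat -> 'I_n).

Let g := entry_sum G.

Definition residual k : 'cV[R]_n := G *m iterate x0 s k - b.

Definition min_residual k : R := vmin n_gt0 (residual k).

Notation r := residual.
Notation m := min_residual.

Lemma min_residual_le k i : m k <= r k i 0.
Proof. by have [_] := vminP n_gt0 (r k). Qed.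

Lemma min_residual_attained k : exists i, m k = r k i 0.
Proof. by have [] := vminP n_gt0 (r k). Qed.

Lemma infeasible_min_residual k : ~~ feasible G b (iterate x0 s k) -> m k < 0.
Proof.
rewrite negb_forall => /existsP[i]; rewrite -ltNge => lt_i.
apply: le_lt_trans (min_residual_le k i) _.
by rewrite /residual !mxE subr_lt0; rewrite mxE in lt_i.
Qed.

Lemma residualS k i : r k.+1 i 0 = r k i 0 + G i (s k).
Proof.
rewrite /residual /= mulmxDr addrAC mxE; congr (_ + _).
rewrite mxE (bigD1 (s k)) //= mxE !eqxx mulr1 big1 ?addr0 // => j /negbTE jsk.
by rewrite mxE jsk mulr0.
Qed.

Lemma residual_lipschitz u d i : `|r (u + d) i 0 - r u i 0| <= g * d%:R.
Proof.
elim: d => [|d IHd]; first by rewrite addn0 subrr normr0 mulr0.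
rewrite addnS residualS addrAC -natr1 mulrDr mulr1.
by apply: le_trans (ler_normD _ _) _; apply: lerD => //; apply: entry_le.
Qed.

Lemma residual_near u d i :
  (r u i 0 <= r (u + d) i 0 + g * d%:R) /\ (r (u + d) i 0 <= r u i 0 + g * d%:R).
Proof.
by have := residual_lipschitz u d i; rewrite ler_norml => /andP[? ?]; split; lra.
Qed.

Lemma min_residual_near u d : m u <= m (u + d) + g * d%:R.
Proof.
have [i ->] := min_residual_attained (u + d).
apply: le_trans (min_residual_le u i) _.
by have [] := residual_near u d i.
Qed.

Definition selected t l : {set 'I_n} := [set s (t - d.+1)%N | d : 'I_l].

Lemma selectedP t l i :
  reflect (exists2 d, (d < l)%N & i = s (t - d.+1)%N) (i \in selected t l).
Proof.
apply: (iffP imsetP) => [[d _ ->]|[d lt_dl ->]]; first by exists d.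
by exists (Ordinal lt_dl).
Qed.

Lemma subset_selected t l l' : (l <= l')%N -> selected t l \subset selected t l'.
Proof.
move=> le_ll'; apply/subsetP => i /selectedP[d lt_dl ->].
by apply/selectedP; exists d => //; apply: leq_trans le_ll'.
Qed.

Definition window_count a l : 'cV[R]_n := \sum_(a <= u < a + l) delta_mx (s u) 0.

Lemma iterate_window a l :
  iterate x0 s (a + l) = iterate x0 s a + window_count a l.
Proof.
rewrite /window_count; elim: l => [|l IHl]; first by rewrite addn0 big_geq ?addr0.
by rewrite addnS big_nat_recr ?leq_addr //= IHl addrA.
Qed.

Lemma window_count_dot a l (v : 'cV[R]_n) :
  ((window_count a l)^T *m v) 0 0 = \sum_(a <= u < a + l) v (s u) 0.
Proof.
rewrite /window_count linear_sum /= mulmx_suml summxE; apply: eq_bigr => u _.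
by rewrite trmx_delta -rowE mxE.
Qed.

Lemma window_count_sum a l : \sum_i window_count a l i 0 = l%:R.
Proof.
have := window_count_dot a l (const_mx 1); rewrite mxE.
under eq_bigr do rewrite !mxE mulr1.
move=> ->; under eq_bigr do rewrite mxE.
by rewrite big_const_nat addKn iter_addr addr0.
Qed.

Section Drift.
Variable kappa : R.
Hypothesis kappa_gt0 : 0 < kappa.
Hypothesis kappaP :
  forall x : 'cV[R]_n, (\sum_i x i 0) ^+ 2 <= kappa * (x^T *m G *m x) 0 0.

(** With N the counts of the window, N^T G N is the sum over the steps of the
    window of the total change of the residual of the index selected there. *)
Lemma window_drift a l D : (0 < l)%N ->
  (forall i, i \in selected (a + l) l -> r (a + l) i 0 <= m (a + l) + D) ->
  l%:R <= kappa * (m (a + l) - m a + D).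
Proof.
move=> l_gt0 nearD; set N := window_count a l.
have GN : G *m N = r (a + l) - r a.
  by rewrite /residual iterate_window mulmxDr [_ + _ - b]addrAC [RHS]addrAC subrr add0r.
have quadN : (N^T *m G *m N) 0 0 <= l%:R * (m (a + l) - m a + D).
  rewrite -mulmxA GN window_count_dot.
  have -> : l%:R * (m (a + l) - m a + D) =
      \sum_(a <= u < a + l) (m (a + l) - m a + D).
    by rewrite big_const_nat addKn iter_addr addr0 mulr_natl.
  rewrite big_seq [leRHS]big_seq; apply: ler_sum => u.
  rewrite mem_index_iota => /andP[le_au lt_ual].
  have su : s u \in selected (a + l) l.
    apply/selectedP; exists (a + l - u.+1)%N.
      by rewrite ltn_subLR // ltn_add2r ltnS.
    by rewrite -subSn // subSS subKn // ltnW.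
  have := nearD _ su; have := min_residual_le a (s u).
  have -> : (r (a + l) - r a) (s u) 0 = r (a + l) (s u) 0 - r a (s u) 0.
    by rewrite [LHS]mxE [X in _ + X]mxE.
  lra.
have l0 : 0 < l%:R :> R by rewrite ltr0n.
have := le_trans (kappaP N) (ler_wpM2l (ltW kappa_gt0) quadN).
by rewrite window_count_sum expr2 mulrCA ler_pM2l.
Qed.

Variable t : nat.
Hypothesis selectableP :
  forall k, (k < t)%N -> selectable n_gt0 G b B (iterate x0 s k) (s k).

(** The index was within B of the minimum when it was selected; since then,
    its residual and the minimum have each moved by at most g l. *)
Lemma recent_near_vmin t' l i : (t' <= t)%N -> (l <= t')%N ->
  i \in selected t' l -> r t' i 0 <= m t' + (B + 2 * g * l%:R).
Proof.
move=> le_t't le_lt' /selectedP[d lt_dl ->]; set u := (t' - d.+1)%N.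
have le_dt' : (d.+1 <= t')%N by apply: leq_trans le_lt'.
have t'E : t' = (u + d.+1)%N by rewrite subnK.
have lt_ut : (u < t)%N by apply: leq_trans le_t't; rewrite t'E addnS ltnS leq_addr.
have sel : r u (s u) 0 <= m u + B := selectableP lt_ut.
have [_ near_r] := residual_near u d.+1 (s u).
have near_m := min_residual_near u d.+1.
have gd : g * d.+1%:R <= g * l%:R.
  by rewrite ler_wpM2l ?entry_sum_ge0 // ler_nat.
by rewrite t'E; lra.
Qed.

Variables q M : nat.
Hypothesis q_large : 2 * kappa * (1 + 2 * g) <= q%:R.
Hypothesis q_gt0 : (0 < q)%N.
Hypothesis M_gt0 : (0 < M)%N.
Hypothesis B_le_M : B <= M%:R.

(** Among the lengths q^j M, two consecutive ones see the same selected
    indices. On the longer window, the slack D of [window_drift] is then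
    controlled by the shorter length, and so by half of the longer one. *)
Lemma drift t' : (t' <= t)%N -> (q ^ n.+1 * M <= t')%N ->
  exists2 l, (0 < l <= t')%N & m (t' - l) + l%:R / (2 * kappa) <= m t'.
Proof.
move=> le_t't le_Lt'; pose len j := (q ^ j * M)%N.
have len_le j k : (j <= k)%N -> (len j <= len k)%N.
  by move=> le_jk; rewrite leq_mul2r leq_pexp2l // orbT.
have [j le_jn Sj] : exists2 j, (j <= n)%N &
    selected t' (len j.+1) = selected t' (len j).
  by apply: increasing_sets_repeat => j; apply/subset_selected/len_le.
have le_t' k : (k <= n.+1)%N -> (len k <= t')%N.
  by move=> le_kn; apply: leq_trans le_Lt'; apply: len_le.
have l_gt0 : (0 < len j.+1)%N by rewrite muln_gt0 expn_gt0 q_gt0.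
have t'E : t' = (t' - len j.+1 + len j.+1)%N by rewrite subnK // le_t'.
exists (len j.+1); first by rewrite l_gt0 le_t'.
have /(window_drift l_gt0) : forall i,
    i \in selected (t' - len j.+1 + len j.+1) (len j.+1) ->
    r (t' - len j.+1 + len j.+1) i 0 <=
      m (t' - len j.+1 + len j.+1) + (B + 2 * g * (len j)%:R).
  rewrite -t'E => i; rewrite Sj; apply: recent_near_vmin => //.
  by apply: le_t'; apply: leq_trans le_jn _.
rewrite -t'E; set l' := (len j)%:R.
have -> : (len j.+1)%:R = q%:R * l' :> R by rewrite /l' -natrM mulnA -expnS.
have B_le : B <= l'.
  by apply: le_trans B_le_M _; rewrite ler_nat leq_pmull // expn_gt0 q_gt0.
have l'_ge0 : 0 <= l' by rewrite ler0n.
have half : 2 * kappa * (B + 2 * g * l') <= q%:R * l'.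
  apply: le_trans (ler_wpM2r l'_ge0 q_large).
  rewrite -[leRHS]mulrA ler_wpM2l //; first by rewrite mulr_ge0 // ltW.
  by rewrite [leRHS]mulrDl mul1r lerD2r.
move=> H; rewrite -lerBrDl ler_pdivrMr; last by rewrite mulr_gt0.
set D := B + _ in H half; set Q := q%:R * l' in H half *.
have -> : (m t' - m (t' - len j.+1)) * (2 * kappa) =
  2 * (kappa * (m t' - m (t' - len j.+1) + D)) - 2 * kappa * D by ring.
lra.
Qed.

(** The windows of [drift] telescope backwards from t' until fewer than
    q^(n+1) M steps remain, on which m decreases by at most g per step. *)
Lemma vmin_growth t' : (t' <= t)%N ->
  m 0 - g * (q ^ n.+1 * M)%:R + (t'%:R - (q ^ n.+1 * M)%:R) / (2 * kappa) <= m t'.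
Proof.
have k2_gt0 : 0 < 2 * kappa by rewrite mulr_gt0.
set L := (q ^ n.+1 * M)%N.
have [k] := ubnP t'; elim: k t' => // k IHk t' lt_t'k le_t't.
have [le_Lt'|lt_t'L] := leqP L t'.
  have [l /andP[l_gt0 le_lt'] dr] := drift le_t't le_Lt'.
  have := IHk (t' - l)%N; rewrite (leq_trans (leq_subr _ _) le_t't) => IH.
  have lt_k : (t' - l < k)%N.
    rewrite -ltnS; apply: leq_ltn_trans lt_t'k.
    by rewrite ltn_subrL l_gt0 (leq_trans l_gt0).
  by have {IH} := IH lt_k isT; rewrite natrB // => IH; lra.
have near := min_residual_near 0 t'; rewrite add0n in near.
have lt_t'L' : t'%:R <= L%:R :> R by rewrite ler_nat ltnW.
have neg : (t'%:R - L%:R) / (2 * kappa) <= 0.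
  by rewrite ler_pdivrMr // mul0r subr_le0.
have gL : g * t'%:R <= g * L%:R by rewrite ler_wpM2l // entry_sum_ge0.
lra.
Qed.

End Drift.

(** Since min_residual is still negative at time k, its linear growth from
    an initial value at least - g rho bounds k. *)
Lemma running_time_le kappa q k : 0 < kappa ->
  (forall x : 'cV[R]_n, (\sum_i x i 0) ^+ 2 <= kappa * (x^T *m G *m x) 0 0) ->
  2 * kappa * (1 + 2 * g) <= q%:R -> (0 < q)%N -> G \in unitmx -> 0 <= B ->
  admissible n_gt0 G b B x0 s ->
  (forall j, (j <= k)%N -> ~~ feasible G b (iterate x0 s j)) ->
  k%:R <= (1 + 2 * kappa * g) * (q ^ n.+1)%:R * (1 + B) +
          2 * kappa * g * norm2 (x0 - invmx G *m b).
Proof.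
move=> kappa_gt0 kappaP q_large q_gt0 Gunit B_ge0 adm run.
have sel j : (j < k)%N -> selectable n_gt0 G b B (iterate x0 s j) (s j).
  by move=> lt_jk; apply: adm => i le_ij; apply/run/(leq_trans le_ij)/ltnW.
pose M := (Num.truncn B).+1.
have B_le_M : B <= M%:R by exact/ltW/truncnS_gt.
have M_le : M%:R <= 1 + B by rewrite -natr1 addrC lerD2l truncn_le.
have grow := vmin_growth kappa_gt0 kappaP sel q_large q_gt0 (ltn0Sn _) B_le_M
  (leqnn k).
have m_lt0 := infeasible_min_residual (run k (leqnn k)).
have m0_ge : - (g * norm2 (x0 - invmx G *m b)) <= m 0.
  have [i ->] := min_residual_attained 0.
  have -> : r 0 = G *m (x0 - invmx G *m b) by rewrite mulmxBr mulKVmx.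
  exact: mulmx_coord_ge.
have g_ge0 : 0 <= g := entry_sum_ge0 G.
have k2_gt0 : 0 < 2 * kappa by rewrite mulr_gt0.
move: grow; rewrite natrM -/M; set Q := (q ^ n.+1)%:R; set rho := norm2 _ in m0_ge *.
move=> grow.
have : (k%:R - Q * M%:R) / (2 * kappa) <= g * rho + g * (Q * M%:R) by lra.
rewrite ler_pdivrMr // => bound.
have QM : (1 + 2 * kappa * g) * Q * M%:R <= (1 + 2 * kappa * g) * Q * (1 + B).
  by rewrite ler_wpM2l // mulr_ge0 ?ler0n // addr_ge0 // mulr_ge0 // ltW.
lra.
Qed.

End Run.

(** * The stopping time *)

Theorem corollary4 (R : realType) (n : nat) (n_gt0 : (0 < n)%N) (G : 'M[R]_n)
    (G_posdef : posdefmx (sympart G)) :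
  (forall (b : 'cV[R]_n) (B : R) (x0 : 'cV[R]_n) (s : nat -> 'I_n),
     0 <= B -> admissible n_gt0 G b B x0 s ->
     exists T : nat, stops_at G b x0 s T) /\
  (exists C : R, 1 <= C /\
     forall (b : 'cV[R]_n) (B : R) (x0 : 'cV[R]_n) (s : nat -> 'I_n) (T : nat),
       0 <= B -> admissible n_gt0 G b B x0 s -> stops_at G b x0 s T ->
       T%:R <= Num.sqrt n%:R *
         (C * (1 + B) + (C + 1) * norm2 (x0 - invmx G *m b))).
Proof.
have Gunit := posdef_sympart_unitmx G_posdef.
have [kappa kappa_gt0 kappaP] := sum_sq_le_quad G_posdef.
set g := entry_sum G; have g_ge0 : 0 <= g := entry_sum_ge0 G.
pose q := (Num.truncn (2 * kappa * (1 + 2 * g))).+1.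
have q_large : 2 * kappa * (1 + 2 * g) <= q%:R by exact/ltW/truncnS_gt.
have time_le b B x0 s k := @running_time_le R n n_gt0 G b B x0 s kappa q k
  kappa_gt0 kappaP q_large (ltn0Sn _) Gunit.
split=> [b B x0 s B_ge0 adm|].
  pose bound := (1 + 2 * kappa * g) * (q ^ n.+1)%:R * (1 + B) +
    2 * kappa * g * norm2 (x0 - invmx G *m b).
  pose K := (Num.truncn bound).+1.
  have [/existsP[k feas]|] :=
      boolP [exists k : 'I_K.+1, feasible G b (iterate x0 s k)].
    have ex : exists k, feasible G b (iterate x0 s k) by exists k.
    exists (ex_minn ex); case: ex_minnP => T feasT minT; split=> // j lt_jT.
    by apply: contraL lt_jT => /minT; rewrite leqNgt.
  rewrite negb_exists => /forallP run.
  have /time_le : forall j, (j <= K)%N -> ~~ feasible G b (iterate x0 s j).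
    by move=> j le_jK; apply: (run (Ordinal (le_jK : (j < K.+1)%N))).
  by move=> /(_ _ B_ge0 adm); rewrite leNgt truncnS_gt.
(* The additional 1 accounts for the last correction, as the bound on the
   running time applies to the last infeasible index T - 1. *)
exists (1 + (1 + 2 * kappa * g) * (q ^ n.+1)%:R).
have kg_ge0 : 0 <= 2 * kappa * g by rewrite mulr_ge0 // mulr_ge0 // ltW.
have Q_ge1 : 1 <= (q ^ n.+1)%:R :> R by rewrite ler1n expn_gt0.
set Q := (q ^ n.+1)%:R in Q_ge1 time_le *.
have C_ge : 2 * kappa * g <= (1 + 2 * kappa * g) * Q by nra.
split; first by nra.
move=> b B x0 s T B_ge0 adm [_ run].
set rho := norm2 _; have rho_ge0 : 0 <= rho by apply: sqrtr_ge0.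
set E := (X in _ <= _ * X).
have T_le : T%:R <= E.
  case: T run => [|k] run; first by rewrite /E; nra.
  have := time_le b B x0 s k B_ge0 adm run; rewrite -(natr1 k) -/rho -/g /E.
  have := ler_wpM2r rho_ge0 C_ge.
  lra.
apply: le_trans T_le _; rewrite ler_peMl //; first by rewrite /E; nra.
by rewrite -[leLHS]sqrtr1; apply: ler_wsqrtr; rewrite ler1n.
Qed.
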